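(* Let $\Lambda$ be a ring, let $f:A\to B$ be a homomorphism of right $\Lambda$-modules with cokernel $C$, and let $F$ be the functor from left $\Lambda$-modules to abelian groups defined by the exact sequence $$0\to F\to A\otimes-\xrightarrow{f\otimes-}B\otimes-\to C\otimes-\to0 .$$ Let $f=me$ be an epi-mono factorization of $f$, with $e:A\to D$ an epimorphism and $m:D\to B$ a monomorphism, and let $K:=\mathrm{Ker}(m\otimes-:D\otimes-\to B\otimes-)$. Then $K\simeq\underline{F}$, the quot-stabilization of $F$, and $$0\to K\to D\otimes-\xrightarrow{m\otimes-}B\otimes-\to C\otimes-\to0$$ is a tensor copresentation of $\underline{F}$.
   Context: Tensor products are over $\Lambda$. An additive functor from left $\Lambda$-modules to abelian groups is tensor-copresented if it is isomorphic to the kernel of a natural transformation $A\otimes-\to B\otimes-$ for some right $\Lambda$-modules $A,B$; an exact sequence $0\to F\to A\otimes-\to B\otimes-$ (possibly extended on the right by the cokernel $C\otimes-\to0$) is called a tensor copresentation of $F$. For a covariant additive functor $F$, the quot-stabilization $\underline{F}$ is the cokernel of the canonical natural transformation $\lambda_F:L_0F\to F$ from the zeroth left-derived functor; equivalently $\underline{F}(X)=\mathrm{Coker}(F(\pi):F(P)\to F(X))$ for any epimorphism $\pi:P\to X$ with $P$ projective. *)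

(* Defs.v *)
From HB Require Import structures.
From mathcomp Require Import all_boot all_algebra ring_quotient.
From mathcomp Require Import finmap boolp classical_sets functions cardinality fsbigop.

Set Implicit Arguments.
Unset Strict Implicit.
Unset Printing Implicit Defensive.

Import GRing.Theory.
Local Open Scope classical_set_scope.
Local Open Scope quotient_scope.
Local Open Scope ring_scope.

(* Left modules over L are [lmodType L].  Right modules over L are
   [lmodType L^c]: the right action "a r" is written [(r : L^c) *: a].
   Abelian groups are [zmodType], and their morphisms are [{additive U -> V}]. *)

Definition surjective (U V : Type) (h : U -> V) := forall y, exists x, h x = y.

Definition is_cokernel (R : pzRingType) (A B C : lmodType R)
    (f : {linear A -> B}) (c : {linear B -> C}) :=
  surjective c /\ forall y, c y = 0 <-> exists x, f x = y.

Definition projective (R : pzRingType) (P : lmodType R) :=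
  forall (M N : lmodType R) (p : {linear M -> N}) (g : {linear P -> N}),
  surjective p -> exists h : {linear P -> M}, forall x, p (h x) = g x.

Section FreeModule.
Variables (L : pzRingType) (X : choiceType).

Definition finsupp : {pred X -> L^o} :=
  fun u => `[< finite_set (u @^-1` [set~ 0]) >].

Fact finsupp_closed : subsemimod_closed finsupp.
Proof.
split; first split.
- apply/asboolP; apply: (@sub_finite_set _ _ set0) => // x /=; exact.
- move=> u v /asboolP fu /asboolP fv; apply/asboolP.
  have fuv : finite_set (u @^-1` [set~ 0] `|` v @^-1` [set~ 0]).
    by rewrite finite_setU.
  apply: sub_finite_set fuv => x /= uv0; apply: contrapT => /not_orP[] /=.
  move=> /contrapT u0 /contrapT v0; apply: uv0.
  by rewrite -[(u + v) x]/(u x + v x) u0 v0 addr0.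
- move=> a u /asboolP fu; apply/asboolP; apply: sub_finite_set fu => x /= au0 u0.
  by apply: au0; rewrite -[(a *: u) x]/(a * u x) u0 mulr0.
Qed.

Record free := Free { coef_fun : X -> L^o; _ : coef_fun \in finsupp }.
HB.instance Definition _ := [isSub for coef_fun].
HB.instance Definition _ := [Choice of free by <:].
HB.instance Definition _ :=
  GRing.SubChoice_isSubLmodule.Build L _ finsupp free finsupp_closed.

Definition coef (u : free) (x : X) : L := coef_fun u x.

Lemma coef_finite u : finite_set (coef u @^-1` [set~ 0]).
Proof. by case: u => u uP; apply/asboolP. Qed.

Fact gen_subproof x : (fun y => (y == x)%:R : L^o) \in finsupp.
Proof.
apply/asboolP; apply: (@sub_finite_set _ _ [set x]) => [y /= y0|].
  by apply: contrapT => /eqP/negPf yx; apply: y0; rewrite yx.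
exact: finite_set1.
Qed.

Definition gen x : free := Free (gen_subproof x).

Definition extend (M : lmodType L) (g : X -> M) (u : free) : M :=
  \sum_(x \in [set: X]) coef u x *: g x.

Section Extend.
Variables (M : lmodType L) (g : X -> M).

Lemma extend_sub (s : {fset X}) u : (forall x, x \notin s -> coef u x = 0) ->
  extend g u = \sum_(x <- s) coef u x *: g x.
Proof. by move=> us; apply: fsbigTE => x /us ->; rewrite scale0r. Qed.

Lemma coef_support u : exists s : {fset X}, forall x, x \notin s -> coef u x = 0.
Proof.
have /finite_fsetP[s us] := coef_finite u; exists s => x xs.
apply: contrapT => ux; have : (coef u @^-1` [set~ 0]) x by [].
by rewrite us /= (negPf xs).
Qed.

Fact extend_is_linear : linear (extend g).
Proof.
move=> a u v; have [s us] := coef_support u; have [t vt] := coef_support v.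
have Us x : x \notin (s `|` t)%fset -> coef u x = 0.
  by rewrite in_fsetU negb_or => /andP[/us].
have Vs x : x \notin (s `|` t)%fset -> coef v x = 0.
  by rewrite in_fsetU negb_or => /andP[_ /vt].
rewrite (extend_sub Us) (extend_sub Vs) (@extend_sub (s `|` t)%fset); last first.
  move=> x xs; rewrite -[LHS]/(a * coef u x + coef v x).
  by rewrite Us// Vs// mulr0 addr0.
rewrite scaler_sumr -big_split/=; apply: eq_bigr => x _.
by rewrite scalerA -scalerDl.
Qed.

HB.instance Definition _ :=
  GRing.isLinear.Build L free M *:%R (extend g) extend_is_linear.

Lemma extend_gen x : extend g (gen x) = g x.
Proof.
rewrite (@extend_sub [fset x]%fset) => [|y]; last first.
  by rewrite in_fset1 /= => /negPf ->.
by rewrite big_seq_fset1 /= eqxx scale1r.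
Qed.

End Extend.

Lemma free_sum u : exists s : seq X, u = \sum_(x <- s) coef u x *: gen x.
Proof.
have [s us] := coef_support u; exists s.
apply/val_inj/funext => y; rewrite raddf_sum fct_sumE /=.
rewrite -[LHS]/(coef u y); have [ys|ys] := boolP (y \in s); last first.
  rewrite us// big_seq big1// => x xs; rewrite -[LHS]/(_ * _).
  by case: eqP xs ys => [-> ->//|_ _ _]; rewrite mulr0.
rewrite (bigD1_seq y)//= -[X in _ = X + _]/(_ * _) eqxx mulr1 big1 ?addr0//.
by move=> x /negPf xy; rewrite -[LHS]/(_ * _) eq_sym xy mulr0.
Qed.

Lemma free_eq (M : lmodType L) (h k : {linear free -> M}) :
  (forall x, h (gen x) = k (gen x)) -> h =1 k.
Proof.
move=> hk u; have [s ->] := free_sum u; rewrite !linear_sum.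
by apply: eq_bigr => x _; rewrite !linearZ hk.
Qed.

End FreeModule.

Lemma free_eqz (X : choiceType) (V : zmodType) (h k : {additive free int X -> V}) :
  (forall x, h (gen _ x) = k (gen _ x)) -> h =1 k.
Proof.
move=> hk u; have [s ->] := free_sum u; rewrite !raddf_sum.
by apply: eq_bigr => x _; rewrite -[coef u x]intz !scaler_int !raddfMz hk.
Qed.

Section Kernel.
Variables (U V : zmodType) (h : {additive U -> V}).

Definition kerp : {pred U} := fun x => h x == 0.

Fact kerp_closed : zmod_closed kerp.
Proof.
split=> [|x y /eqP hx /eqP hy]; first by apply/eqP; rewrite raddf0.
by apply/eqP; rewrite raddfB hx hy subr0.
Qed.

Record ker_type := Ker { kval : U; _ : kval \in kerp }.
HB.instance Definition _ := [isSub for kval].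
HB.instance Definition _ := [Choice of ker_type by <:].
HB.instance Definition _ :=
  GRing.SubChoice_isSubZmodule.Build U kerp ker_type kerp_closed.

Definition ker : zmodType := ker_type.

Lemma kvalP (x : ker) : h (kval x) = 0.
Proof. by case: x => x xP; apply/eqP. Qed.

Fact kval_is_additive : zmod_morphism kval.
Proof. by []. Qed.
HB.instance Definition _ :=
  GRing.isZmodMorphism.Build ker_type U kval kval_is_additive.

Definition kincl : {additive ker -> U} := kval.

Definition imp : {pred V} := fun y => `[< exists x, h x = y >].

Fact imp_closed : zmod_closed imp.
Proof.
split=> [|_ _ /asboolP[x <-] /asboolP[y <-]]; apply/asboolP.
  by exists 0; rewrite raddf0.
by exists (x - y); rewrite raddfB.
Qed.
HB.instance Definition _ := GRing.isZmodClosed.Build V imp imp_closed.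

Definition im : zmodClosed V := imp.

Definition coker : zmodType := Quotient.quot im.

End Kernel.

Section KernelMap.
Variables (U V U' V' : zmodType).
Variables (h : {additive U -> V}) (h' : {additive U' -> V'}).
Variables (g : {additive U -> U'}).
Hypothesis hg : forall x, h x = 0 -> h' (g x) = 0.

Fact ker_map_subproof (x : ker h) : g (kval x) \in kerp h'.
Proof. by apply/eqP; rewrite hg// kvalP. Qed.

Definition ker_map_fun (x : ker h) : ker h' := Ker (ker_map_subproof x).

Fact ker_map_is_additive : zmod_morphism ker_map_fun.
Proof. by move=> x y; apply/val_inj; rewrite /= !raddfB. Qed.
HB.instance Definition _ :=
  GRing.isZmodMorphism.Build _ _ ker_map_fun ker_map_is_additive.

Definition ker_map : {additive ker h -> ker h'} := ker_map_fun.

End KernelMap.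

Section QuotientMap.
Variables (V : zmodType) (I : zmodClosed V).

Definition proj (x : V) : Quotient.quot I := \pi x.

Fact proj_is_additive : zmod_morphism proj.
Proof. by move=> x y; rewrite /proj !piE. Qed.
HB.instance Definition _ := GRing.isZmodMorphism.Build _ _ proj proj_is_additive.

Lemma proj_eq0 x : proj x = 0 <-> x \in I.
Proof.
rewrite -[x in X in _ <-> X]subr0 Quotient.idealrBE /proj.
by split=> [x0|/eqP ->]; [apply/eqP; rewrite x0|]; rewrite piE.
Qed.

Lemma proj_surj q : exists x, proj x = q.
Proof. by exists (repr q); rewrite /proj reprK. Qed.

Variables (W : zmodType) (h : {additive V -> W}).
Hypothesis hI : forall x, x \in I -> h x = 0.

Definition quot_lift of (forall x, x \in I -> h x = 0) :=
  fun q : Quotient.quot I => h (repr q).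

Lemma quot_lift_proj x : quot_lift hI (proj x) = h x.
Proof.
apply/eqP; rewrite -subr_eq0 -raddfB; apply/eqP/hI.
by rewrite Quotient.idealrBE reprK.
Qed.

Fact quot_lift_is_additive : zmod_morphism (quot_lift hI).
Proof.
move=> p q; have [x <-] := proj_surj p; have [y <-] := proj_surj q.
by rewrite -raddfB !quot_lift_proj raddfB.
Qed.
HB.instance Definition _ :=
  GRing.isZmodMorphism.Build _ _ (quot_lift hI) quot_lift_is_additive.

End QuotientMap.

Section CokernelMap.
Variables (U V : zmodType) (h : {additive U -> V}).

Definition coker_proj : {additive V -> coker h} := proj (im h).

Lemma coker_proj_eq0 y : coker_proj y = 0 <-> exists x, h x = y.
Proof. by rewrite proj_eq0; split=> /asboolP. Qed.

Lemma coker_proj_surj q : exists y, coker_proj y = q.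
Proof. exact: proj_surj. Qed.

Lemma coker_eq (W : zmodType) (k k' : {additive coker h -> W}) :
  (forall y, k (coker_proj y) = k' (coker_proj y)) -> k =1 k'.
Proof. by move=> kk' q; have [y <-] := coker_proj_surj q. Qed.

Section Lift.
Variables (W : zmodType) (k : {additive V -> W}).
Hypothesis kh : forall x, k (h x) = 0.

Fact coker_lift_subproof y : y \in imp h -> k y = 0.
Proof. by case/asboolP=> x <-. Qed.

Definition coker_lift : {additive coker h -> W} := quot_lift coker_lift_subproof.

Lemma coker_lift_proj y : coker_lift (coker_proj y) = k y.
Proof. exact: quot_lift_proj. Qed.
End Lift.
End CokernelMap.

Section CokernelFunctoriality.
Variables (U V U' V' : zmodType).
Variables (h : {additive U -> V}) (h' : {additive U' -> V'}).
Variable g : {additive V -> V'}.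
Hypothesis hg : forall x, exists x', h' x' = g (h x).

Fact coker_map_subproof x : (coker_proj h' \o g) (h x) = 0.
Proof. exact/coker_proj_eq0/hg. Qed.

Definition coker_map : {additive coker h -> coker h'} :=
  coker_lift coker_map_subproof.

Lemma coker_map_proj y : coker_map (coker_proj h y) = coker_proj h' (g y).
Proof. exact: coker_lift_proj. Qed.
End CokernelFunctoriality.

Section CokernelLaws.
Variables (U V U' V' U'' V'' : zmodType).
Variables (h : {additive U -> V}) (h' : {additive U' -> V'}).
Variables (h'' : {additive U'' -> V''}).

Lemma coker_map_eq (g k : {additive V -> V'}) hg hk :
  (forall y, coker_proj h' (g y) = coker_proj h' (k y)) ->
  @coker_map _ _ _ _ h h' g hg =1 @coker_map _ _ _ _ h h' k hk.
Proof. by move=> gk; apply: coker_eq => y; rewrite !coker_map_proj. Qed.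

Lemma coker_map_id (g : {additive V -> V}) hg :
  (forall y, coker_proj h (g y) = coker_proj h y) ->
  @coker_map _ _ _ _ h h g hg =1 id.
Proof.
by move=> g1 q; have [y <-] := coker_proj_surj q; rewrite coker_map_proj.
Qed.

Lemma coker_map_comp (g : {additive V -> V'}) (g' : {additive V' -> V''})
    (k : {additive V -> V''}) hg hg' hk :
  (forall y, coker_proj h'' (k y) = coker_proj h'' (g' (g y))) ->
  @coker_map _ _ _ _ h h'' k hk =1
  @coker_map _ _ _ _ h' h'' g' hg' \o @coker_map _ _ _ _ h h' g hg.
Proof.
move=> kE q; have [y <-] := coker_proj_surj q.
by rewrite [RHS](congr1 _ (coker_map_proj _ _)) !coker_map_proj.
Qed.

Lemma coker_mapD (g g' k : {additive V -> V'}) hg hg' hk :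
  (forall y, coker_proj h' (k y) = coker_proj h' (g y + g' y)) ->
  @coker_map _ _ _ _ h h' k hk =1
  @coker_map _ _ _ _ h h' g hg \+ @coker_map _ _ _ _ h h' g' hg'.
Proof.
move=> kE q; have [y <-] := coker_proj_surj q.
by rewrite coker_map_proj kE raddfD -[RHS]/(_ + _) !coker_map_proj.
Qed.
End CokernelLaws.

Arguments proj : simpl never.
Arguments quot_lift : simpl never.
Arguments coker_proj : simpl never.
Arguments coker_lift : simpl never.
Arguments coker_map : simpl never.

Section Tensor.
Variables (L : pzRingType) (A : lmodType L^c) (X : lmodType L).

Let word (a : A) (x : X) : free int (A * X)%type := gen int (a, x).

(* The subgroup generated by the relations of the tensor product, as the
   intersection of all subgroups that contain them. *)
Definition tensor_rel : {pred free int (A * X)%type} := fun z =>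
  `[< forall I : zmodClosed (free int (A * X)%type),
        (forall a a' x, word (a + a') x - word a x - word a' x \in I) ->
        (forall a x x', word a (x + x') - word a x - word a x' \in I) ->
        (forall (r : L) a x, word ((r : L^c) *: a) x - word a (r *: x) \in I) ->
      z \in I >].

Fact tensor_rel_closed : zmod_closed tensor_rel.
Proof.
split=> [|u v /asboolP Iu /asboolP Iv]; apply/asboolP => I I1 I2 I3.
  exact: rpred0.
by apply: rpredB; [apply: Iu|apply: Iv].
Qed.
HB.instance Definition _ :=
  GRing.isZmodClosed.Build _ tensor_rel tensor_rel_closed.

Definition relations : zmodClosed (free int (A * X)%type) := tensor_rel.

Definition tensor : zmodType := Quotient.quot relations.

Definition tens (a : A) (x : X) : tensor := proj relations (word a x).

Let tens0 z : (forall I : zmodClosed (free int (A * X)%type),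
        (forall a a' x, word (a + a') x - word a x - word a' x \in I) ->
        (forall a x x', word a (x + x') - word a x - word a x' \in I) ->
        (forall (r : L) a x, word ((r : L^c) *: a) x - word a (r *: x) \in I) ->
      z \in I) -> proj relations z = 0.
Proof. by move=> zI; apply/proj_eq0/asboolP. Qed.

Lemma tensDl a a' x : tens (a + a') x = tens a x + tens a' x.
Proof.
apply/eqP; rewrite -subr_eq0 opprD addrA -!raddfB.
by apply/eqP/tens0 => I + _ _; apply.
Qed.

Lemma tensDr a x x' : tens a (x + x') = tens a x + tens a x'.
Proof.
apply/eqP; rewrite -subr_eq0 opprD addrA -!raddfB.
by apply/eqP/tens0 => I _ + _; apply.
Qed.

Lemma tensZ (r : L) a x : tens ((r : L^c) *: a) x = tens a (r *: x).
Proof.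
apply/eqP; rewrite -subr_eq0 -!raddfB.
by apply/eqP/tens0 => I _ _; apply.
Qed.

Lemma tensor_eq (V : zmodType) (h k : {additive tensor -> V}) :
  (forall a x, h (tens a x) = k (tens a x)) -> h =1 k.
Proof.
move=> hk q; have [z <-] := proj_surj q.
by apply: (@free_eqz _ _ (h \o proj relations) (k \o proj relations)) => -[a x]; apply: hk.
Qed.

Definition balanced (V : zmodType) (b : A -> X -> V) :=
  [/\ forall a a' x, b (a + a') x = b a x + b a' x,
      forall a x x', b a (x + x') = b a x + b a x'
    & forall (r : L) a x, b ((r : L^c) *: a) x = b a (r *: x)].

Section Lift.
Variables (V : zmodType) (b : A -> X -> V).
Hypothesis bP : balanced b.

Definition tensor_pre_fun : free int (A * X)%type -> V :=
  extend (fun p => b p.1 p.2 : zmodule V).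

Fact tensor_pre_is_additive : zmod_morphism tensor_pre_fun.
Proof. exact: (raddfB (extend (fun p => b p.1 p.2 : zmodule V))). Qed.
HB.instance Definition _ :=
  GRing.isZmodMorphism.Build _ V tensor_pre_fun tensor_pre_is_additive.

Definition tensor_pre : {additive free int (A * X)%type -> V} := tensor_pre_fun.

Lemma tensor_preE a x : tensor_pre (word a x) = b a x.
Proof. exact: (extend_gen (fun p => b p.1 p.2 : zmodule V)). Qed.

Fact tensor_lift_subproof z : z \in tensor_rel -> tensor_pre z = 0.
Proof.
have [b1 b2 b3] := bP; have [k0 kB] := kerp_closed tensor_pre.
pose kC := GRing.isZmodClosed.Build _ (kerp tensor_pre) (kerp_closed tensor_pre).
pose I : zmodClosed _ := HB.pack (kerp tensor_pre) kC.
move=> /asboolP/(_ I) zI; apply/eqP/zI => *; apply/eqP;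
  rewrite !raddfB /= !tensor_preE ?b1 ?b2 ?b3 ?subrr//.
- by rewrite [X in X - _]addrAC subrr add0r subrr.
- by rewrite [X in X - _]addrAC subrr add0r subrr.
Qed.

Definition tensor_lift : {additive tensor -> V} :=
  quot_lift tensor_lift_subproof.

Lemma tensor_liftE a x : tensor_lift (tens a x) = b a x.
Proof. exact: etrans (quot_lift_proj _ _) (tensor_preE _ _). Qed.
End Lift.
End Tensor.

Section TensorMap.
Variables (L : pzRingType) (A B : lmodType L^c) (X Y : lmodType L).
Variables (f : {linear A -> B}) (g : {linear X -> Y}).

Fact tensor_map_subproof : balanced (fun a x => tens (f a) (g x)).
Proof.
split=> *; rewrite ?raddfD ?tensDl ?tensDr//.
by rewrite !linearZ /= tensZ.
Qed.

Definition tensor_map : {additive tensor A X -> tensor B Y} :=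
  tensor_lift tensor_map_subproof.

Lemma tensor_mapE a x : tensor_map (tens a x) = tens (f a) (g x).
Proof. exact: tensor_liftE. Qed.
End TensorMap.

Section TensorLaws.
Variables (L : pzRingType) (A B : lmodType L^c) (X Y Z : lmodType L).

Lemma tensor_map_eq (f f' : {linear A -> B}) (g g' : {linear X -> Y}) :
  f =1 f' -> g =1 g' -> tensor_map f g =1 tensor_map f' g'.
Proof.
by move=> ff' gg'; apply: tensor_eq => a x; rewrite !tensor_mapE ff' gg'.
Qed.

Lemma tensor_map_id : tensor_map (@idfun A) (@idfun X) =1 id.
Proof.
apply: (@tensor_eq _ _ _ _ (tensor_map idfun idfun) idfun) => a x.
exact: tensor_mapE.
Qed.

Lemma tensor_map_comp (C : lmodType L^c) (f' : {linear B -> C})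
    (f : {linear A -> B}) (g' : {linear Y -> Z}) (g : {linear X -> Y}) :
  tensor_map (f' \o f) (g' \o g) =1 tensor_map f' g' \o tensor_map f g.
Proof.
apply: (@tensor_eq _ _ _ _ (tensor_map (f' \o f) (g' \o g))
  (tensor_map f' g' \o tensor_map f g)) => a x.
by rewrite tensor_mapE [RHS](congr1 _ (tensor_mapE _ _ _ _)) tensor_mapE.
Qed.

Lemma tensor_mapD (f : {linear A -> B}) (g g' : {linear X -> Y}) :
  tensor_map f (g \+ g') =1 tensor_map f g \+ tensor_map f g'.
Proof.
apply: (@tensor_eq _ _ _ _ (tensor_map f (g \+ g'))
  (tensor_map f g \+ tensor_map f g')) => a x.
by rewrite tensor_mapE -[RHS]/(_ + _) !tensor_mapE -tensDr.
Qed.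
End TensorLaws.

Arguments tens : simpl never.
Arguments tensor_map : simpl never.

(* [fmap_eq]: maps of modules are identified when they agree pointwise. *)
Record functor (L : pzRingType) := Functor {
  fobj :> lmodType L -> zmodType;
  fmap : forall X Y : lmodType L, {linear X -> Y} -> {additive fobj X -> fobj Y};
  fmap_eq : forall (X Y : lmodType L) (f g : {linear X -> Y}),
    f =1 g -> fmap f =1 fmap g;
  fmap_id : forall X : lmodType L, fmap (@idfun X) =1 id;
  fmap_comp : forall (X Y Z : lmodType L)
      (g : {linear Y -> Z}) (f : {linear X -> Y}),
    fmap (g \o f) =1 fmap g \o fmap f;
  fmapD : forall (X Y : lmodType L) (f g : {linear X -> Y}),
    fmap (f \+ g) =1 fmap f \+ fmap g
}.
Arguments fmap {L} F {X Y} f : rename.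

Record nattrans (L : pzRingType) (F G : functor L) := NatTrans {
  component :> forall X : lmodType L, {additive F X -> G X};
  naturality : forall (X Y : lmodType L) (f : {linear X -> Y}) (x : F X),
    component Y (fmap F f x) = fmap G f (component X x)
}.

Section Functors.
Variable L : pzRingType.
Implicit Types F G H : functor L.

Definition mutually_inverse F G (phi : nattrans F G) (psi : nattrans G F) :=
  forall X : lmodType L, cancel (phi X) (psi X) /\ cancel (psi X) (phi X).

Definition monic F G (alpha : nattrans F G) :=
  forall X : lmodType L, injective (alpha X).

Definition epic F G (alpha : nattrans F G) :=
  forall X : lmodType L, surjective (alpha X).

Definition exact F G H (alpha : nattrans F G) (beta : nattrans G H) :=
  forall (X : lmodType L) (y : G X), beta X y = 0 <-> exists x, alpha X x = y.

Section Comp.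
Variables (F G H : functor L) (beta : nattrans G H) (alpha : nattrans F G).

Definition nt_comp : nattrans F H.
Proof.
by exists (fun X => beta X \o alpha X) => X Y f x /=; rewrite !naturality.
Defined.
End Comp.

Section Kernels.
Variables (F G : functor L) (alpha : nattrans F G).

Fact kerF_subproof (X Y : lmodType L) (f : {linear X -> Y}) x :
  alpha X x = 0 -> alpha Y (fmap F f x) = 0.
Proof. by rewrite naturality => ->; rewrite raddf0. Qed.

Definition kerF : functor L.
Proof.
exists (fun X : lmodType L => ker (alpha X))
  (fun X Y f => ker_map (@kerF_subproof X Y f)).
- by move=> X Y f g fg x; apply/val_inj/fmap_eq.
- by move=> X x; apply/val_inj/fmap_id.
- by move=> X Y Z g f x; apply/val_inj/fmap_comp.
- by move=> X Y f g x; apply/val_inj/fmapD.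
Defined.

Definition ker_incl : nattrans kerF F.
Proof. by exists (fun X => kincl (alpha X)). Defined.

Fact cokerF_subproof (X Y : lmodType L) (f : {linear X -> Y}) x :
  exists x', alpha Y x' = fmap G f (alpha X x).
Proof. by exists (fmap F f x); rewrite naturality. Qed.

Definition cokerF : functor L.
Proof.
exists (fun X : lmodType L => coker (alpha X))
  (fun X Y f => coker_map (@cokerF_subproof X Y f)).
- by move=> X Y f g fg; apply: coker_map_eq => y; rewrite (fmap_eq fg).
- by move=> X; apply: coker_map_id => y; rewrite fmap_id.
- by move=> X Y Z g f; apply: coker_map_comp => y; rewrite fmap_comp.
- by move=> X Y f g; apply: coker_mapD => y; rewrite fmapD.
Defined.

Definition coker_quot : nattrans G cokerF.
Proof.
exists (fun X => coker_proj (alpha X)) => X Y f x.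
by rewrite [RHS](coker_map_proj (@cokerF_subproof X Y f)).
Defined.
End Kernels.

Section TensorFunctor.

Definition tensF (A : lmodType L^c) : functor L.
Proof.
exists (fun X : lmodType L => tensor A X)
  (fun X Y f => tensor_map (@idfun A) f).
- by move=> X Y f g; apply: tensor_map_eq.
- by move=> X; apply: tensor_map_id.
- by move=> X Y Z g f x; rewrite -tensor_map_comp; apply: tensor_map_eq.
- by move=> X Y f g; apply: tensor_mapD.
Defined.

Definition tensN (A B : lmodType L^c) (f : {linear A -> B}) :
  nattrans (tensF A) (tensF B).
Proof.
exists (fun X : lmodType L => tensor_map f (@idfun X)) => X Y g x.
rewrite -[LHS]tensor_map_comp -[RHS]tensor_map_comp.
exact: tensor_map_eq.
Defined.

End TensorFunctor.

Section DerivedZero.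
Variable F : functor L.

(* A functorial free presentation P1 X -> P0 X -> X -> 0: P0 X is free on the
   set X, and P1 X is free on the kernel of the augmentation P0 X -> X. *)
Definition P0 (X : lmodType L) : lmodType L := free L X.
Definition aug (X : lmodType L) : {linear P0 X -> X} := extend (fun x : X => x).
Definition P1 (X : lmodType L) : lmodType L := free L (ker (aug X)).
Definition bd (X : lmodType L) : {linear P1 X -> P0 X} :=
  extend (fun z : ker (aug X) => kval z : P0 X).

Definition P0_map (X Y : lmodType L) (f : {linear X -> Y}) : {linear P0 X -> P0 Y} :=
  extend (fun x : X => gen L (f x) : P0 Y).

Lemma P0_mapE (X Y : lmodType L) (f : {linear X -> Y}) x :
  P0_map f (gen L x) = gen L (f x).
Proof. exact: (extend_gen (fun x : X => gen L (f x) : P0 Y)). Qed.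

Lemma augE (X : lmodType L) (x : X) : aug X (gen L x) = x.
Proof. exact: (extend_gen (fun x : X => x)). Qed.

Lemma bdE (X : lmodType L) (z : ker (aug X)) : bd X (gen L z) = kval z.
Proof. exact: (extend_gen (fun z : ker (aug X) => kval z : P0 X)). Qed.

Lemma aug_nat (X Y : lmodType L) (f : {linear X -> Y}) u :
  aug Y (P0_map f u) = f (aug X u).
Proof.
apply: (@free_eq _ _ _ (aug Y \o P0_map f) (f \o aug X)) => x /=.
by rewrite P0_mapE !augE.
Qed.

Lemma aug_bd (X : lmodType L) u : aug X (bd X u) = 0.
Proof.
apply: (@free_eq _ _ _ (aug X \o bd X) \0) => z /=.
by rewrite bdE; apply: kvalP.
Qed.

Lemma bd_lift (Y : lmodType L) (T : choiceType) (h : {linear free L T -> P0 Y}) :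
  (forall u, aug Y (h u) = 0) ->
  exists k : {linear free L T -> P1 Y}, forall u, bd Y (k u) = h u.
Proof.
move=> h0; have hK u : h u \in kerp (aug Y) by apply/eqP/h0.
exists (extend (fun t => gen L (Ker (hK (gen L t))) : P1 Y)) => u.
apply: (@free_eq _ _ _ (bd Y \o extend _) h) => t /=.
by rewrite extend_gen bdE.
Qed.

Lemma fmap_bd_lift (Y : lmodType L) (T : choiceType)
    (h : {linear free L T -> P0 Y}) : (forall u, aug Y (h u) = 0) ->
  forall x, exists x', fmap F (bd Y) x' = fmap F h x.
Proof.
move=> /bd_lift[k kh] x; exists (fmap F k x).
by rewrite -[LHS]fmap_comp; apply: fmap_eq => u; apply: kh.
Qed.

Fact L0_subproof (X Y : lmodType L) (f : {linear X -> Y}) x :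
  exists x', fmap F (bd Y) x' = fmap F (P0_map f) (fmap F (bd X) x).
Proof.
have [u|x' E] := @fmap_bd_lift Y _ (P0_map f \o bd X) _ x.
  by rewrite /= aug_nat aug_bd raddf0.
by exists x'; rewrite E fmap_comp.
Qed.

Let fmap_eq_mod (X Y : lmodType L) (h k : {linear P0 X -> P0 Y}) x :
  (forall u, aug Y (h u) = aug Y (k u)) ->
  coker_proj (fmap F (bd Y)) (fmap F h x) = coker_proj (fmap F (bd Y)) (fmap F k x).
Proof.
move=> hk; pose d : {linear P0 X -> P0 Y} := h \- k.
have [|x' x'E] := @fmap_bd_lift Y X d _ x.
  by move=> u; apply: etrans (raddfB _ _ _) _; apply/eqP; rewrite subr_eq0; apply/eqP/hk.
have -> : fmap F h x = fmap F d x + fmap F k x.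
  rewrite -[RHS]fmapD; apply: fmap_eq => u.
  by rewrite -[RHS]/(h u - k u + k u) subrK.
rewrite raddfD [X in X + _](_ : _ = 0) ?add0r//.
by apply/coker_proj_eq0; exists x'.
Qed.

Definition L0 : functor L.
Proof.
exists (fun X : lmodType L => coker (fmap F (bd X)))
  (fun X Y f => coker_map (@L0_subproof X Y f)).
- move=> X Y f g fg; apply: coker_map_eq => y; apply: fmap_eq_mod => u.
  by rewrite !aug_nat fg.
- move=> X; apply: coker_map_id => y.
  rewrite -[in RHS](fmap_id y); apply: fmap_eq_mod => u.
  by rewrite aug_nat.
- move=> X Y Z g f; apply: coker_map_comp => y.
  rewrite -[fmap F (P0_map g) _]fmap_comp; apply: fmap_eq_mod => u.
  by rewrite aug_nat [RHS](aug_nat g (P0_map f u)) aug_nat.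
- move=> X Y f g; apply: coker_mapD => y.
  rewrite -[_ + _]fmapD; apply: fmap_eq_mod => u.
  rewrite aug_nat [RHS](raddfD (aug Y) (P0_map f u) (P0_map g u)).
  exact: esym (congr2 +%R (aug_nat f u) (aug_nat g u)).
Defined.

Fact lambda_subproof (X : lmodType L) x : fmap F (aug X) (fmap F (bd X) x) = 0.
Proof.
rewrite -[LHS]fmap_comp.
have E u : (aug X \o bd X) u = (\0 : {linear P1 X -> X}) u by apply: aug_bd.
rewrite (fmap_eq E); apply: (addrI (fmap F \0 x)).
rewrite addr0 -[LHS]fmapD; apply: fmap_eq => u /=; exact: addr0.
Qed.

Definition lambda : nattrans L0 F.
Proof.
exists (fun X => coker_lift (@lambda_subproof X)) => X Y f q.
have [y <-] := coker_proj_surj q.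
rewrite /= coker_map_proj !coker_lift_proj.
by rewrite -[LHS]fmap_comp -[RHS]fmap_comp; apply: fmap_eq => u; apply: aug_nat.
Defined.

Lemma lambda_proj (X : lmodType L) y :
  lambda X (coker_proj _ y) = fmap F (aug X) y.
Proof. exact: coker_lift_proj. Qed.

Definition quot_stab : functor L := cokerF lambda.

Lemma quot_stab_projective (P X : lmodType L) (p : {linear P -> X}) :
  projective P -> surjective p ->
  surjective (coker_quot lambda X) /\
  forall x, coker_quot lambda X x = 0 <-> exists y, fmap F p y = x.
Proof.
move=> projP psurj; split; first exact: coker_proj_surj.
move=> x; apply: iff_trans (coker_proj_eq0 _ _) _; split=> [[q <-]|[y <-]].
  have [y <-] := coker_proj_surj q; have [s sK] := choice psurj.
  pose k : {linear P0 X -> P} := extend s.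
  exists (fmap F k y); rewrite lambda_proj -[LHS]fmap_comp; apply: fmap_eq.
  apply: (@free_eq _ _ _ (p \o k) (aug X)) => t; rewrite augE.
  exact: etrans (congr1 p (extend_gen s t)) (sK t).
have [|h hE] := projP _ _ (aug X) p; first by move=> t; exists (gen L t); apply: augE.
exists (coker_proj _ (fmap F h y)); rewrite lambda_proj -[LHS]fmap_comp.
exact: fmap_eq.
Qed.

End DerivedZero.

Definition tensor_copresentation F (A B : lmodType L^c)
    (i : nattrans F (tensF A)) (f : {linear A -> B}) :=
  monic i /\ exact i (tensN f).

Definition tensor_copresentation_coker F (A B C : lmodType L^c)
    (i : nattrans F (tensF A)) (f : {linear A -> B}) (c : {linear B -> C}) :=
  [/\ tensor_copresentation i f, exact (tensN f) (tensN c) & epic (tensN c)].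

End Functors.

(* Main.v *)
(* Composing i : F -> A (x) - with e (x) - gives a map F -> K, which is epic since
   e (x) X is onto.  Its kernel at X is the image of F P -> F X for P -> X free:
   F P dies in K P = 0, as free modules are flat; conversely an element of F X
   killed by e (x) X is a sum of a (x) x with e a = 0, so it lifts to an element
   of A (x) P killed by e (x) P, hence by f (x) P, that is, to F P.  As lambda_F
   has the same image, K is the cokernel of lambda_F. *)
From HB Require Import structures.
Require Import Defs.
From mathcomp Require Import all_boot all_algebra.
From mathcomp Require Import finmap boolp.

Set Implicit Arguments.
Unset Strict Implicit.
Unset Printing Implicit Defensive.

(* Restores [free] and [monic], which MathComp shadows. *)
Import Defs.
Import GRing.Theory.
Local Open Scope ring_scope.

Arguments tensor_lift : simpl never.

(** * Pure tensors as generators *)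

Section TensorElements.
Variables (L : pzRingType) (A : lmodType L^c) (X : lmodType L).

Lemma tens0r (a : A) : tens a (0 : X) = 0.
Proof. by apply: (addrI (tens a (0 : X))); rewrite -tensDr !addr0. Qed.

Lemma tens0l (x : X) : tens (0 : A) x = 0.
Proof. by apply: (addrI (tens (0 : A) x)); rewrite -tensDl !addr0. Qed.

Lemma tensNl (a : A) (x : X) : tens (- a) x = - tens a x.
Proof. by apply: (addrI (tens a x)); rewrite -tensDl !subrr tens0l. Qed.

Lemma tensMnl (a : A) (x : X) n : tens (a *+ n) x = tens a x *+ n.
Proof. by elim: n => [|n IHn]; rewrite ?mulr0n ?tens0l// !mulrS tensDl IHn. Qed.

Lemma tensMzl (a : A) (x : X) n : tens (a *~ n) x = tens a x *~ n.
Proof. by case: n => n; rewrite ?NegzE ?mulrNz ?tensNl -!pmulrn tensMnl. Qed.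

Lemma tensor_sum (q : tensor A X) :
  exists s : seq (A * X), q = \sum_(p <- s) tens p.1 p.2.
Proof.
have [u <-] := proj_surj q; have [s us] := free_sum u.
(* The integer coefficients of a representative are absorbed into the left factors. *)
exists [seq (p.1 *~ coef u p, p.2) | p <- s].
rewrite big_map [in LHS]us raddf_sum; apply: eq_bigr => -[a x] _ /=.
by rewrite -[coef u _]intz scaler_int raddfMz intz tensMzl.
Qed.

Lemma tensor_ind (P : tensor A X -> Prop) :
  P 0 -> (forall a x, P (tens a x)) -> (forall u v, P u -> P v -> P (u + v)) ->
  forall q, P q.
Proof.
by move=> P0 Pt PD q; have [s ->] := tensor_sum q; apply: big_ind => // -[].
Qed.

End TensorElements.

Lemma tensor_map_surjective (L : pzRingType) (A B : lmodType L^c)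
    (X Y : lmodType L) (f : {linear A -> B}) (g : {linear X -> Y}) :
  surjective f -> surjective g -> surjective (tensor_map f g).
Proof.
move=> fS gS; apply: tensor_ind => [|b y|u v [u' <-] [v' <-]].
- by exists 0; rewrite raddf0.
- have [a <-] := fS b; have [x <-] := gS y.
  by exists (tens a x); rewrite tensor_mapE.
- by exists (u' + v'); rewrite raddfD.
Qed.

(* Since c is onto, q factors through c (x) X: the value on y (x) x is
   q (b (x) x) for any preimage b of y. *)
Lemma tensor_map_factor (L : pzRingType) (B C : lmodType L^c) (X : lmodType L)
    (c : {linear B -> C}) (V : zmodType) (q : {additive tensor B X -> V}) :
  surjective c -> (forall b x, c b = 0 -> q (tens b x) = 0) ->
  forall z, tensor_map c (@idfun X) z = 0 -> q z = 0.
Proof.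
move=> /choice[s sK] q0.
have qE b b' x : c b = c b' -> q (tens b x) = q (tens b' x).
  move=> cb; apply/eqP; rewrite -subr_eq0 -raddfB -tensNl -tensDl.
  by apply/eqP/q0; rewrite raddfB /= cb subrr.
(* The section [s] need not be linear; by [qE] its defects are invisible to [q]. *)
have sP : balanced (fun y x => q (tens (s y) x)).
  split=> [y y' x|y x x'|r y x].
  - by rewrite -raddfD -tensDl; apply: qE; rewrite raddfD /= !sK.
  - by rewrite tensDr raddfD.
  - by rewrite -tensZ; apply: qE; rewrite linearZ /= !sK.
have qf : q =1 tensor_lift sP \o tensor_map c idfun.
  apply: (@tensor_eq _ _ _ _ q (tensor_lift sP \o tensor_map c idfun)) => b x.
  rewrite [RHS](congr1 _ (tensor_mapE _ _ _ _)) [RHS](tensor_liftE sP).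
  by apply: qE; rewrite sK.
move=> z z0; rewrite qf.
by rewrite [LHS](congr1 (tensor_lift sP) z0) raddf0.
Qed.

(** * Flatness of free modules *)

Section TensorFree.
Variables (L : pzRingType) (T : choiceType).

Fact coord_balanced (A : lmodType L^c) (t : T) :
  balanced (fun (a : A) (u : free L T) => (coef u t : L^c) *: a).
Proof.
split=> [a a' u|a u v|r a u]; first exact: scalerDr.
- by rewrite -[coef (u + v) t]/(coef u t + coef v t) scalerDl.
- by rewrite scalerA.
Qed.

(** Under the identification of A (x) L^(T) with a direct sum of copies of A, this is the projection
    to the copy at [t]. *)
Definition coord (A : lmodType L^c) (t : T) : {additive tensor A (free L T) -> A} :=
  tensor_lift (coord_balanced A t).

Lemma coordE (A : lmodType L^c) t (a : A) (u : free L T) :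
  coord A t (tens a u) = (coef u t : L^c) *: a.
Proof. exact: tensor_liftE. Qed.

Lemma coord_map (A B : lmodType L^c) (m : {linear A -> B}) t z :
  coord B t (tensor_map m idfun z) = m (coord A t z).
Proof.
apply: (@tensor_eq _ _ _ _ (coord B t \o tensor_map m idfun) (m \o coord A t)).
move=> a u; rewrite [LHS](congr1 _ (tensor_mapE _ _ _ _)).
by rewrite [RHS](congr1 m (coordE _ _ _)) coordE linearZ.
Qed.

Lemma free_expansion (u : free L T) (s : {fset T}) :
  (forall t, t \notin s -> coef u t = 0) ->
  u = \sum_(t <- s) coef u t *: gen L t.
Proof.
move=> us; rewrite -(extend_sub (@gen L T) us).
by apply/esym/(@free_eq _ _ _ (extend (@gen L T)) idfun) => t; apply: extend_gen.
Qed.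

Lemma tensor_free_expansion (A : lmodType L^c) (z : tensor A (free L T)) :
  exists s : {fset T}, z = \sum_(t <- s) tens (coord A t z) (gen L t).
Proof.
(* Allowing every larger index set lets the expansions of two summands be taken over a common
   one. *)
suff [s /(_ s (fsubset_refl s))] : exists s : {fset T}, forall s' : {fset T},
    (s `<=` s')%fset -> z = \sum_(t <- s') tens (coord A t z) (gen L t).
  by exists s.
move: z; apply: tensor_ind => [|a u|u v [s us] [t vt]].
- by exists fset0 => s _; rewrite big1// => t _; rewrite raddf0 tens0l.
- have [s us] := coef_support u; exists s => s' /fsubsetP ss'.
  have us' t : t \notin s' -> coef u t = 0.
    by move=> ts'; apply/us/(contra _ ts')/ss'.
  rewrite [in LHS](free_expansion us').
  rewrite (big_morph (tens a) (tensDr a) (tens0r _ a)).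
  by apply: eq_bigr => t _; rewrite coordE tensZ.
- exists (s `|` t)%fset => s'; rewrite fsubUset => /andP[/us us' /vt vs'].
  rewrite [in LHS]us' [in LHS]vs' -big_split /=; apply: eq_bigr => x _.
  by rewrite raddfD tensDl.
Qed.

(** Coordinates commute with m (x) -, so those of a kernel element are killed by the injective [m]
    and vanish; an element is determined by its coordinates. *)
Lemma tensor_free_flat (A B : lmodType L^c) (m : {linear A -> B}) :
  injective m -> injective (tensor_map m (@idfun (free L T))).
Proof.
move=> mI; apply: raddf_inj => z mz; have [s ->] := tensor_free_expansion z.
rewrite big1// => t _; rewrite (_ : coord A t z = 0) ?tens0l//.
by apply: mI; rewrite -coord_map mz !raddf0.
Qed.

End TensorFree.

(** * Right exactness of the tensor product *)

Section RightExactness.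
Variables (L : pzRingType) (A B C : lmodType L^c).
Variables (f : {linear A -> B}) (c : {linear B -> C}).

Lemma tensN_exact : is_cokernel f c -> exact (tensN f) (tensN c).
Proof.
move=> [cS cE] X y; split=> [y0|[x <-]].
  apply/coker_proj_eq0.
  (* The projection to the cokernel of f (x) X kills b (x) x whenever c b = 0, since then b = f a;
     hence it factors through c (x) X. *)
  apply: (tensor_map_factor (q := coker_proj (tensor_map f idfun)) cS) y0.
  move=> b x /cE[a <-]; apply/coker_proj_eq0.
  by exists (tens a x); rewrite tensor_mapE.
move: x; apply: tensor_ind => [|a x|u v u0 v0].
- by rewrite !raddf0.
- have cfa : c (f a) = 0 by apply/cE; exists a.
  rewrite [LHS](congr1 (tensN c X) (tensor_mapE f idfun a x)).
  by rewrite [LHS]tensor_mapE cfa tens0l.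
- by rewrite !raddfD u0 v0 addr0.
Qed.

Lemma tensN_epic : surjective c -> epic (tensN c).
Proof. by move=> cS X; apply: tensor_map_surjective => // x; exists x. Qed.

End RightExactness.

(** As [e] is onto, [f] and [m] have the same image. *)
Lemma is_cokernel_precomp (R : pzRingType) (A B C D : lmodType R)
    (f : {linear A -> B}) (c : {linear B -> C})
    (e : {linear A -> D}) (m : {linear D -> B}) :
  is_cokernel f c -> f =1 m \o e -> surjective e -> is_cokernel m c.
Proof.
move=> [cS cE] fE eS; split=> // y; apply: iff_trans (cE y) _.
split=> [[a <-]|[d <-]]; first by exists (e a); rewrite fE.
by have [a <-] := eS d; exists a; rewrite fE.
Qed.

(* A (x) (P0 X) -> A (x) X stays onto on the kernels of e (x) -, because the
   kernel of e (x) X is generated by the a (x) x with e a = 0. *)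
Lemma tensor_ker_lift (L : pzRingType) (A D : lmodType L^c) (X : lmodType L)
    (e : {linear A -> D}) (z : tensor A X) :
  surjective e -> tensN e X z = 0 ->
  exists2 w, tensN e (P0 X) w = 0 & fmap (tensF A) (aug X) w = z.
Proof.
(* The claim is that [z] lies in the image of [h], that is, vanishes in its cokernel. *)
move=> eS ez; pose h := fmap (tensF A) (aug X) \o kincl (tensN e (P0 X)).
have : coker_proj h z = 0.
  apply: (tensor_map_factor (q := coker_proj h) eS) ez => a x a0.
  apply/coker_proj_eq0.
  have aK : tens a (gen L x : P0 X) \in kerp (tensN e (P0 X)).
    by apply/eqP; rewrite [LHS]tensor_mapE a0 tens0l.
  by exists (Ker aK); rewrite [LHS]tensor_mapE augE.
by move=> /coker_proj_eq0[w <-]; exists (kval w) => //; apply: kvalP.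
Qed.

(** Injectivity makes chosen preimages unique, which forces them to be additive and natural. *)
Lemma nattrans_inverse (L : pzRingType) (F G : functor L) (alpha : nattrans F G) :
  monic alpha -> epic alpha ->
  exists beta : nattrans G F, mutually_inverse beta alpha.
Proof.
move=> aI aS.
have bP X : {b : G X -> F X | cancel b (alpha X)}.
  by apply: cid; have [b bK] := choice (aS X); exists b.
pose b X := sval (bP X); have bK X : cancel (b X) (alpha X) := svalP (bP X).
have bB X : zmod_morphism (b X).
  by move=> x y; apply: (aI X); rewrite raddfB !bK.
pose b' X : {additive G X -> F X} :=
  HB.pack (b X) (GRing.isZmodMorphism.Build _ _ (b X) (bB X)).
have b'N (X Y : lmodType L) (f : {linear X -> Y}) x :
    b' Y (fmap G f x) = fmap F f (b' X x).
  by apply: (aI Y); rewrite naturality /= !bK.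
by exists (NatTrans b'N) => X; split=> x /=; rewrite ?bK//; apply: (aI X); rewrite bK.
Qed.

(** * Recognizing the quot-stabilization as a cokernel of [lambda F] *)

Section QuotientStabilization.
Variables (L : pzRingType) (F G : functor L) (alpha : nattrans F G).
Hypotheses (alphaS : epic alpha) (alphaE : exact (lambda F) alpha).

Fact quot_stab_lift_subproof (X : lmodType L) x : alpha X (lambda F X x) = 0.
Proof. by apply/alphaE; exists x. Qed.

Definition quot_stab_lift : nattrans (quot_stab F) G.
Proof.
exists (fun X => coker_lift (@quot_stab_lift_subproof X)) => X Y f q.
have [y <-] := coker_proj_surj q.
rewrite -[coker_proj _ y]/(coker_quot (lambda F) X y) -naturality.
by rewrite /= !coker_lift_proj naturality.
Defined.

Lemma quot_stab_lift_monic : monic quot_stab_lift.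
Proof.
move=> X; apply: raddf_inj => q; have [y <-] := coker_proj_surj q.
by rewrite /= coker_lift_proj => /alphaE y0; apply/coker_proj_eq0.
Qed.

Lemma quot_stab_lift_epic : epic quot_stab_lift.
Proof.
move=> X y; have [x <-] := alphaS y.
by exists (coker_proj _ x); rewrite /= coker_lift_proj.
Qed.

End QuotientStabilization.

(** F (aug X) is the surjection from F (P0 X) to L0 F X followed by [lambda F X], so both have the
    same image. *)
Lemma exact_lambda (L : pzRingType) (F G : functor L) (alpha : nattrans F G) :
  (forall X x, alpha X x = 0 <-> exists y, fmap F (aug X) y = x) ->
  exact (lambda F) alpha.
Proof.
move=> aE X x; apply: iff_trans (aE X x) _; split=> [[y <-]|[q <-]].
  by exists (coker_proj _ y); rewrite lambda_proj.
by have [y <-] := coker_proj_surj q; exists y; rewrite lambda_proj.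
Qed.

(** * The map from F to K and its kernel *)

Section Factorization.
Variables (L : pzRingType) (A B D : lmodType L^c) (f : {linear A -> B}).
Variables (F : functor L) (i : nattrans F (tensF A)).
Variables (e : {linear A -> D}) (m : {linear D -> B}).
Hypotheses (iP : tensor_copresentation i f) (fE : f =1 m \o e).

Lemma tensN_factor (X : lmodType L) z : tensN m X (tensN e X z) = tensN f X z.
Proof.
by rewrite -[LHS]tensor_map_comp; apply: tensor_map_eq => // a; rewrite fE.
Qed.

Fact to_ker_subproof (X : lmodType L) (x : F X) :
  tensN e X (i X x) \in kerp (tensN m X).
Proof.
by have [_ iE] := iP; apply/eqP; rewrite tensN_factor; apply/iE; exists x.
Qed.

Definition to_ker_fun (X : lmodType L) (x : F X) : ker (tensN m X) :=
  Ker (to_ker_subproof x).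

Fact to_ker_is_additive (X : lmodType L) : zmod_morphism (@to_ker_fun X).
Proof. by move=> x y; apply/val_inj; rewrite /= !raddfB. Qed.
HB.instance Definition _ (X : lmodType L) := GRing.isZmodMorphism.Build
  (F X) (ker (tensN m X)) (@to_ker_fun X) (@to_ker_is_additive X).

Definition to_ker_additive (X : lmodType L) : {additive F X -> ker (tensN m X)} :=
  @to_ker_fun X.

Definition to_ker : nattrans F (kerF (tensN m)).
Proof.
exists to_ker_additive => X Y g x; apply/val_inj.
by rewrite -[LHS]/(tensN e Y _) !naturality.
Defined.

Lemma to_kerE (X : lmodType L) (x : F X) : kval (to_ker X x) = tensN e X (i X x).
Proof. by []. Qed.

Hypothesis eS : surjective e.

Lemma to_ker_epic : epic to_ker.
Proof.
(* A preimage [a] under e (x) X of an element of K X is killed by f (x) X, so it comes from F X. *)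
move=> X y; have [a ay] := tensN_epic eS (kval y).
have [x xa] : exists x, i X x = a.
  by have [_ iE] := iP; apply/iE; rewrite -tensN_factor ay; apply: kvalP.
by exists x; apply/val_inj; rewrite -[LHS]/(tensN e X _) xa.
Qed.

Hypothesis mI : injective m.

Lemma to_ker_exact : exact (lambda F) to_ker.
Proof.
have [iI iE] := iP; apply: exact_lambda => X x; split=> [x0|[y <-]].
  have [|w ew wx] := @tensor_ker_lift _ _ _ _ _ (i X x) eS.
    by rewrite -to_kerE x0.
  (* Killed by e (x) -, [w] is killed by f (x) - too, so it comes from F (P0 X). *)
  have [y yw] : exists y, i (P0 X) y = w by apply/iE; rewrite -tensN_factor ew raddf0.
  by exists y; apply: (iI X); rewrite naturality yw.
(* By naturality the element passes through K (P0 X), which is zero by flatness of the free module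
   P0 X. *)
rewrite naturality (_ : to_ker _ y = 0) ?raddf0//; apply/val_inj.
by apply: (tensor_free_flat mI); rewrite -[LHS]/(tensN m _ _) kvalP raddf0.
Qed.

End Factorization.

(** Stated for any functor isomorphic to the kernel, so that it serves both for K and for the
    quot-stabilization. *)
Lemma ker_incl_copresentation (L : pzRingType) (A B C : lmodType L^c)
    (f : {linear A -> B}) (c : {linear B -> C}) (F : functor L)
    (phi : nattrans F (kerF (tensN f))) :
  is_cokernel f c -> monic phi -> epic phi ->
  tensor_copresentation_coker (nt_comp (ker_incl (tensN f)) phi) f c.
Proof.
move=> cP pI pS; split; last 2 first.
- exact: tensN_exact.
- by apply: tensN_epic; have [] := cP.
split=> [X x y xy|X y]; first by apply: (pI X); apply: val_inj.
split=> [y0|[x <-]]; last exact: kvalP.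
have yK : y \in kerp (tensN f X) by apply/eqP.
by have [x xy] := pS X (Ker yK); exists x; rewrite /= xy.
Qed.

Theorem theorem7p5 (L : pzRingType) (A B C D : lmodType L^c)
  (f : {linear A -> B}) (c : {linear B -> C})
  (F : functor L) (i : nattrans F (tensF A))
  (e : {linear A -> D}) (m : {linear D -> B}) :
  is_cokernel f c ->
  tensor_copresentation i f ->
  f =1 m \o e -> surjective e -> injective m ->
  let K := kerF (tensN m) in
  let k : nattrans K (tensF D) := ker_incl (tensN m) in
  exists (phi : nattrans K (quot_stab F)) (psi : nattrans (quot_stab F) K),
    [/\ mutually_inverse phi psi,
        tensor_copresentation_coker k m c
      & tensor_copresentation_coker (nt_comp k psi) m c].
Proof.
move=> fc iP fE eS mI K k; have mc := is_cokernel_precomp fc fE eS.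
have jS := to_ker_epic iP fE eS; have jE := to_ker_exact iP fE eS mI.
have psiI : monic (quot_stab_lift jE) by apply: quot_stab_lift_monic.
have psiS : epic (quot_stab_lift jE) by apply: quot_stab_lift_epic.
have [phi phiK] := nattrans_inverse psiI psiS.
exists phi, (quot_stab_lift jE); split=> //; last exact: ker_incl_copresentation.
(* Composing with the identity of K leaves the underlying maps of [k] unchanged, so this case gives
   the copresentation by [k] itself. *)
have id_copres := @ker_incl_copresentation _ _ _ _ m c K
  (NatTrans (component := fun X => idfun) (fun _ _ _ _ => erefl)) mc.
by apply: id_copres => X; [apply: inj_id | move=> x; exists x].
Qed.
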